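(* Let $N\ge1$ and suppose that Assumptions (i), (ii), (iv) of the context hold. Then the equilibrium $\mathcal{Q}^*$ is locally asymptotically stable: there exists $\varepsilon>0$ such that whenever $\|\mathcal{Q}_0-\mathcal{Q}^*\|<\varepsilon$, the solution $(\mathcal{Q}_t)_{t\ge0}$ of the fluid equations with initial state $\mathcal{Q}_0$ satisfies $\mathcal{Q}_t\to\mathcal{Q}^*$ as $t\to\infty$.
   Context: Notation: $[N]=\{1,\dots,N\}$, $\mathbb{R}_+=[0,\infty)$, $\inf\emptyset=\infty$, $\sup\emptyset=-\infty$, $a\wedge b=\min\{a,b\}$, $x\cdot y$ is the dot product. Parameters: $\mu,\Lambda,\lambda_i>0$; weights $\beta=(\beta_1,\dots,\beta_N)$ with all $\beta_i>0$; rebates $r_0<0$ and pairwise different $r_i\ge0$, $i\in[N]$; $F$ is the cumulative distribution function of an atomless distribution on $(0,\infty)$; constants $v,b^{d,i},b^o>0$. For $q\in\mathbb{R}_+^N$ with $\beta\cdot q>0$, $\mu_i(q)=\mu\,\beta_iq^i/(\beta\cdot q)$. For $\gamma>0$, $i^*(\gamma,q)$ is a maximizer over $i\in[N]\cup\{0\}$ of $\gamma r_i-d_i(q)$, where $d_0(q)=0$ and $d_i(q)=\frac{q^i}{v\mu_i(q)}=\frac{\beta\cdot q}{v\mu\beta_i}$ for $i\in[N]$ (the last expression is used also when $q^i=0$); it is unique for all but $F$-null many $\gamma$. Set $\mathcal{S}^i(q)=\{\gamma>0: i=i^*(\gamma,q)\}$ and $\chi_i(q)=\int_{\mathcal{S}^i(q)}dF(\gamma)$,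 $i\in[N]$. Fluid equations with initial state $\mathcal{Q}_0\in\mathbb{R}_+^N\setminus\{0\}$: $$\mathcal{Q}^i_t=\mathcal{Q}^i_0+b^{d,i}\lambda_i t+b^o\Lambda\int_0^t\chi_i(\mathcal{Q}_s)\,ds-v\int_0^t\mu_i(\mathcal{Q}_s)\,ds,\qquad t\ge0,\ i\in[N].$$ Equilibrium: $\mathcal{Q}^*\in\mathbb{R}_+^N$ is the unique solution (existence and uniqueness being taken from earlier work of Maglaras et al.) of $b^{d,i}\lambda_i+b^o\Lambda\chi_i(\mathcal{Q}^* )-v\mu_i(\mathcal{Q}^* )=0$, $i\in[N]$; $\mathcal{W}^*=\beta\cdot\mathcal{Q}^*>0$. Constants: fix a reference vector of initial queue lengths $\hat q\in(0,\infty)^N$ and set $\mathcal{W}_0=\beta\cdot\hat q$, $\beta_{\min}=\min_i\beta_i$, $\beta_{\max}=\max_i\beta_i$, $\kappa=\beta_{\min}\beta_{\max}^{-1}(\mathcal{W}_0\wedge\mathcal{W}^* )$. With $\mathcal{R}_i^-=\{j\in[N]\cup\{0\}:r_j<r_i\}$ and $\mathcal{R}_i^+=\{j\in[N]:r_j>r_i\}$, $$a_i^+=\min_{j\in\mathcal{R}_i^+}\frac{1}{r_j-r_i}\Big(\frac1{\mu\beta_jv}-\frac1{\mu\beta_iv}\Big),\qquad a_i^-=\max_{j\in\mathcal{R}_i^-}\frac1{r_i-r_j}\Big(\frac1{\mu\beta_iv}-\frac{\mathbf 1_{\{j\ne0\}}}{\mu\beta_jv}\Big),$$ and $a^-=\min_{i\in[N]}a_i^->0$.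 Assumptions: (i) $F$ has a density $f=F'$ and $\gamma\mapsto\gamma f(\gamma)$ is strictly decreasing on $[a^-\kappa,\infty)$. (ii) $\sum_{i}b^{d,i}\lambda_i<v\mu<\sum_{i}b^{d,i}\lambda_i+b^o\Lambda$. (iv) $a_i^+\ge a_i^-$ for all $i\in[N]$. *)

(* Defs.v *)
From HB Require Import structures.
From mathcomp Require Import all_boot all_order all_algebra.
From mathcomp Require Import all_classical all_reals all_analysis.

Set Implicit Arguments.
Unset Strict Implicit.
Unset Printing Implicit Defensive.

Import Order.TTheory GRing.Theory Num.Theory.
Import numFieldNormedType.Exports.

Local Open Scope classical_set_scope.
Local Open Scope ring_scope.

(* The index set [N] u {0} is [option 'I_N], with [None] in the role of 0. *)
Record model (R : realType) (N : nat) := Model {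
  mu : R;
  Lambda : R;
  v : R;
  bo : R;
  lambda : 'I_N -> R;
  bd : 'I_N -> R;
  beta : 'I_N -> R;
  r0 : R;
  r : 'I_N -> R;
  law : probability (measurableTypeR R) R;
  mu_gt0 : 0 < mu;
  Lambda_gt0 : 0 < Lambda;
  v_gt0 : 0 < v;
  bo_gt0 : 0 < bo;
  lambda_gt0 : forall i, 0 < lambda i;
  bd_gt0 : forall i, 0 < bd i;
  beta_gt0 : forall i, 0 < beta i;
  r0_lt0 : r0 < 0;
  r_ge0 : forall i, 0 <= r i;
  r_inj : injective r;
  law_pos : law `]0, +oo[%classic = 1%E;
  law_atomless : forall x : R, law [set x] = 0%E
}.

Section Model.
Context {R : realType} {N : nat} (M : model R N).
Implicit Types (q : 'rV[R]_N) (i : 'I_N) (g t : R).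

Definition cdf_law (x : R) : R := fine (law M `]-oo, x]%classic).

Definition workload q : R := \sum_i beta M i * q 0 i.

(* R_+^N minus the origin; as beta > 0, this is the set of q in R_+^N with
   workload q > 0. *)
Definition in_orthant q : Prop := (forall i, 0 <= q 0 i) /\ q != 0.

Definition service i q : R := mu M * (beta M i * q 0 i) / workload q.

Definition rebate (j : option 'I_N) : R := if j is Some i then r M i else r0 M.

(* q^i / (v mu_i(q)) with q^i cancelled, so that it makes sense for q^i = 0. *)
Definition delay q (j : option 'I_N) : R :=
  if j is Some i then workload q / (v M * mu M * beta M i) else 0.

Definition utility g q (j : option 'I_N) : R := g * rebate j - delay q j.

(* Ties are broken arbitrarily. *)
Definition is_best_choice (istar : R -> 'rV[R]_N -> option 'I_N) : Prop :=
  forall g q, 0 < g -> in_orthant q ->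
    forall j, utility g q j <= utility g q (istar g q).

Section Choice.
Variable istar : R -> 'rV[R]_N -> option 'I_N.

Definition chosen_by i q : set R := [set g | 0 < g /\ istar g q = Some i].

Definition chi i q : R := fine (law M (chosen_by i q)).

Definition is_fluid_solution (Q0 : 'rV[R]_N) (Q : R -> 'rV[R]_N) : Prop :=
  forall t, 0 <= t ->
    in_orthant (Q t) /\
    forall i,
      [/\ lebesgue_measure.-integrable `[0, t] (fun s => (chi i (Q s))%:E),
          lebesgue_measure.-integrable `[0, t] (fun s => (service i (Q s))%:E)
        & Q t 0 i = Q0 0 i + bd M i * lambda M i * t
            + bo M * Lambda M * (\int[lebesgue_measure]_(s in `[0, t]) chi i (Q s))
            - v M * (\int[lebesgue_measure]_(s in `[0, t]) service i (Q s))].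

Definition is_equilibrium q : Prop :=
  in_orthant q /\
  forall i, bd M i * lambda M i + bo M * Lambda M * chi i q
            - v M * service i q = 0.

Definition is_unique_equilibrium q : Prop :=
  is_equilibrium q /\ forall q', is_equilibrium q' -> q' = q.

End Choice.

Definition beta_min : R := inf (range (beta M)).
Definition beta_max : R := sup (range (beta M)).

Definition kappa (qhat qstar : 'rV[R]_N) : R :=
  beta_min * beta_max^-1 * Num.min (workload qhat) (workload qstar).

(* 1 / (mu beta_j v), with value 0 at the index 0: the delay per workload. *)
Definition unit_delay (j : option 'I_N) : R :=
  if j is Some i then (mu M * beta M i * v M)^-1 else 0.

Definition a_plus i : \bar R :=
  ereal_inf [set ((r M j - r M i)^-1
                    * (unit_delay (Some j) - unit_delay (Some i)))%:E
            | j in [set j : 'I_N | r M i < r M j]].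

Definition a_minus i : \bar R :=
  ereal_sup [set ((r M i - rebate j)^-1
                    * (unit_delay (Some i) - unit_delay j))%:E
            | j in [set j : option 'I_N | rebate j < r M i]].

Definition a_minus_min : \bar R := ereal_inf (range a_minus).

Definition is_density (f : R -> R) : Prop :=
  [/\ measurable_fun setT f, forall x, 0 <= f x
    & forall A : set R, measurable A ->
        law M A = (\int[lebesgue_measure]_(x in A) (f x)%:E)%E].

(* [f] is a density of the law, and f = F' holds pointwise on the open half-line
   from a^- kappa, where the values of f matter; below it F only has to be
   absolutely continuous. *)
Definition assumption_i (f : R -> R) (qhat qstar : 'rV[R]_N) : Prop :=
  let c := (a_minus_min * (kappa qhat qstar)%:E)%E in
  [/\ is_density f,
      forall x : R, (c < x%:E)%E -> is_derive x 1 cdf_law (f x)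
    & forall x y : R, (c <= x%:E)%E -> x < y -> y * f y < x * f x].

Definition assumption_ii : Prop :=
  \sum_i bd M i * lambda M i < v M * mu M
    < \sum_i bd M i * lambda M i + bo M * Lambda M.

Definition assumption_iv : Prop := forall i, (a_minus i <= a_plus i)%E.

End Model.

(* Main.v *)
(* Delays depend on q only through the workload W = beta . q, so class i gets the
   share F(a_i^+ W) - F(a_i^- W) of the market orders.  For N >= 2, (iv) forces
   the beta_i to be distinct, hence kappa < W^*, and monotonicity of x f(x) makes
   every share nonincreasing at W^*.  With y_i = beta_i q_i, p_i = y_i^*/W^*,
   d_i = y_i - y_i^*, s = W - W^* and m = v mu, the linearised equations are
     d_i' = (m/W) beta_i ((p_i - phi_i) s - d_i),    p_i > 0, sum p_i = 1,
   with phi_i >= 0 proportional to minus the derivative of the i-th share, and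
   phi_i > 0 for the largest rebate.  The diagonal form
   sum d_i^2 / (beta_i (p_i + phi_i)) is a strict Lyapunov function, since with
   x_i = d_i / (p_i + phi_i)
     s sum (p_i - phi_i) x_i = (sum p_i x_i)^2 - (sum phi_i x_i)^2
   and (sum p_i x_i)^2 <= sum p_i x_i^2.  It tolerates the o(s) linearisation
   error, so differentiability of F at the points W^* a_i^+- suffices. *)
Require Import Defs.
From HB Require Import structures.
From mathcomp Require Import all_boot all_order all_algebra.
From mathcomp Require Import all_classical all_reals all_analysis.
From mathcomp Require Import ring lra.
Import Order.TTheory GRing.Theory Num.Theory.
Import numFieldNormedType.Exports.
Local Open Scope classical_set_scope.
Local Open Scope ring_scope.

(** * Scalar differential inequalities: barriers and decay to zero *)

Section DifferentialInequality.
Context {R : realType}.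
Implicit Types (u : R -> R) (a e : R).

Lemma is_derive_cvg u (t l : R) : is_derive t (1 : R) u l -> u x @[x --> t] --> u t.
Proof.
by case=> ut _; apply/differentiable_continuous; exact/derivable1_diffP.
Qed.

Lemma neg_derive_left u (t l : R) : is_derive t (1 : R) u l -> l < 0 ->
  exists2 d, 0 < d & forall s, t - d < s -> s < t -> u t < u s.
Proof.
move=> [ut <-] l0.
have : h^-1 *: (u (h *: 1 + t) - u t) @[h --> 0^'] --> 'D_1 u t := ut.
move=> /cvgr_lt/(_ 0 l0)/nbhs_ballP[d /= d0 dP].
exists d => // s ds st.
have st0 : s - t < 0 by rewrite subr_lt0.
have := dP (s - t); rewrite /ball/= sub0r normrN ltr0_norm// opprB.
rewrite lt_eqF// ltrBlDr -ltrBlDl => /(_ ds isT).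
by rewrite [_%:A]mulr1 subrK [_ *: _]mulrC nmulr_llt0 ?invr_lt0 ?subr_gt0.
Qed.

(** At the infimum of the times after [a] with [e <= u], continuity forces [u = e]. The negative
    derivative there would put [u] above [e] just before, at times that the infimum excludes. *)
Lemma stays_below u (u' : R -> R) a e :
  u x @[x --> a^'+] --> u a ->
  (forall t, a < t -> is_derive t (1 : R) u (u' t)) ->
  u a < e ->
  (forall t, a < t -> u t = e -> u' t < 0) ->
  forall t, a <= t -> u t < e.
Proof.
move=> ua du uae u'neg t; rewrite le_eqVlt => /predU1P[<-//|at_].
rewrite ltNge; apply/negP => eut.
have cu s : a < s -> u x @[x --> s] --> u s by move=> /du; exact: is_derive_cvg.
pose A := [set s | a < s /\ e <= u s].
have At : A t by split.
have lbA : has_lbound A by exists a => s [/ltW].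
have hA : has_inf A by split; first by exists t.
have aA : a < inf A.
  have [d /= d0 dA] := (nbhs_ballP _ _).1 (cvgr_lt _ ua _ uae).
  apply: (@lt_le_trans _ _ (a + d)); first by rewrite ltrDl.
  apply: lb_le_inf => [|s [as_ eus]]; first by exists t.
  rewrite leNgt; apply/negP => sad.
  have : u s < e by apply: dA; rewrite // /ball/= distrC gtr0_norm ?subr_gt0 ?ltrBlDl.
  by rewrite ltNge eus.
have ltA s : a < s -> s < inf A -> u s < e.
  move=> as_ sA; rewrite ltNge; apply/negP => eus.
  by have := ge_inf lbA (conj as_ eus : A s); rewrite leNgt sA.
have : e <= u (inf A).
  rewrite leNgt; apply/negP => uAe.
  have [d /= d0 dA] := (nbhs_ballP _ _).1 (cvgr_lt _ (cu _ aA) _ uAe).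
  have [s As sd] := inf_adherent d0 hA.
  have : u s < e.
    apply: dA; rewrite /ball/= distrC ger0_norm ?ltrBlDl// subr_ge0.
    exact: ge_inf.
  by rewrite ltNge As.2.
have left d : 0 < d -> exists s, [/\ a < s, inf A - d < s & s < inf A].
  move=> d0; exists (Num.max ((a + inf A) / 2) (inf A - d / 2)).
  by rewrite !lt_max !gt_max; split; apply/orP || apply/andP; lra.
rewrite le_eqVlt => /predU1P[uAe|euA].
  have [d d0 dA] := neg_derive_left _ _ _ (du _ aA) (u'neg _ aA (esym uAe)).
  have [s [as_ ds sA]] := left _ d0.
  by have := ltA s as_ sA; rewrite ltNge uAe (ltW (dA _ _ _)).
have [d /= d0 dA] := (nbhs_ballP _ _).1 (cvgr_gt _ (cu _ aA) _ euA).
have [s [as_ ds sA]] := left _ d0.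
have : e < u s by apply: dA; rewrite /ball/= gtr0_norm ?subr_gt0// ltrBlDl -ltrBlDr.
by rewrite ltNge ltW// ltA.
Qed.

(** Once [u] is below a level [e < U], [stays_below] keeps it there. It must get below [e], since
    otherwise its slope would be at most [- c] forever and [u] would become negative. *)
Lemma decay_to_zero u (u' : R -> R) (U : R) :
  u x @[x --> (0 : R)^'+] --> u 0 ->
  (forall t : R, 0 < t -> is_derive t (1 : R) u (u' t)) ->
  (forall t : R, 0 <= t -> 0 <= u t) ->
  u 0 < U ->
  (forall e, 0 < e -> exists2 c : R, 0 < c &
     forall t : R, 0 < t -> e <= u t -> u t < U -> u' t <= - c) ->
  u t @[t --> +oo] --> (0 : R).
Proof.
move=> u0 du upos u0U decr.
have cu (s : R) : 0 < s -> u x @[x --> s] --> u s by move=> /du; exact: is_derive_cvg.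
have below (s e : R) : (0 : R) <= s -> u s < e -> e < U -> forall t, s <= t -> u t < e.
  move=> s0 use eU; apply: stays_below (use) _ => [|t st|t st ut].
  - move: s0; rewrite le_eqVlt => /predU1P[<-//|s0].
    by apply: cvg_at_right_filter; exact: cu.
  - by apply: du; exact: le_lt_trans st.
  - have e0 : 0 < e by apply: le_lt_trans use; exact: upos.
    have [c c0] := decr _ e0; move/(_ t).
    rewrite ut lexx => /(_ (le_lt_trans s0 st) isT eU).
    by move=> /le_lt_trans; apply; rewrite oppr_lt0.
have uU (t : R) : 0 <= t -> u t < U.
  (* The barrier property asks for a level strictly below [U]; the midpoint of [u 0] and [U] is one
     that lies above [u 0]. *)
  move=> t0; apply: (@lt_trans _ _ ((u 0 + U) / 2)); last by lra.
  by apply: (below 0 _ (lexx _)) t0; lra.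
apply/cvgr0Pnorm_lt => e e0.
wlog eU : e e0 / e < U.
  move=> wl; have U0 : 0 < U by apply: le_lt_trans u0U; exact: upos.
  have m0 : 0 < Num.min e (U / 2) by rewrite lt_min e0 divr_gt0.
  have /(wl _ m0) : Num.min e (U / 2) < U by rewrite gt_min; apply/orP; right; lra.
  by apply: filterS => t; rewrite lt_min => /andP[].
have [s s0 use] : exists2 s : R, 0 <= s & u s < e.
  apply: contrapT => /forall2NP h.
  have {}h (t : R) : 0 <= t -> e <= u t.
    by move=> t0; rewrite leNgt; apply/negP => ?; case: (h t).
  have [c c0 cP] := decr _ e0.
  have lin (t : R) : 0 < t -> u t <= u 0 - c * t.
    move=> t0; have [s||s] := @MVT _ u u' 0 t t0.
    - by rewrite in_itv => /andP[s0 _]; exact: du.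
    - apply/(continuous_within_itvP _ t0); split => //.
        by move=> s; rewrite in_itv => /andP[s0 _]; exact: cu.
      by apply: cvg_at_left_filter; exact: cu.
    - rewrite in_itv subr0/= => /andP[s0 _] E.
      have : u' s * t <= - c * t.
        rewrite ler_wpM2r ?(ltW t0)//.
        by apply: cP => //; [apply: h|apply: uU]; exact: ltW.
      by rewrite -E mulNr; lra.
  have u00 := upos 0 (lexx _).
  (* At time [(u 0 + 1) / c] the linear bound equals [-1], against [0 <= u]. *)
  have T0 : 0 < (u 0 + 1) / c by rewrite divr_gt0// ltr_wpDl.
  have := lin _ T0; rewrite [c * _]mulrC divfK ?gt_eqF//.
  by move=> le1; have le2 := upos _ (ltW T0); lra.
near=> t.
have st : s <= t by near: t; exact: (nbhs_pinfty_ge (num_real s)).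
rewrite ger0_norm ?upos ?(le_trans s0)//.
exact: below use eU _ st.
Unshelve. all: by end_near. Qed.

End DifferentialInequality.

(** * Interval probabilities and continuity of the distribution function *)

Section AtomlessLaw.
Context {R : realType} (P : probability (measurableTypeR R) R).
Hypothesis P_atomless : forall x : R, P [set x] = 0%E.
Let F (x : R) : R := fine (P `]-oo, x]%classic).
Implicit Types (x y : R).

Lemma P_itv_fin (i : interval R) : P [set` i] \is a fin_num.
Proof. by apply: fin_num_measure; exact: measurable_itv. Qed.

Lemma law_itvoc x y : x <= y -> P `]x, y]%classic = (F y - F x)%:E.
Proof.
move=> xy; rewrite EFinB !fineK ?P_itv_fin//.
have -> : `]-oo, y]%classic = `]-oo, x] `|` `]x, y] :> set R.
  by rewrite -itv_bndbnd_setU// bnd_simp.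
rewrite measureU//; first by rewrite addeAC subee ?add0e// P_itv_fin.
apply/seteqP; split => // z [] /=; rewrite !in_itv/= => zx /andP[+ _].
by rewrite ltNge zx.
Qed.

Lemma law_itvoo x y : x <= y -> P `]x, y[%classic = (F y - F x)%:E.
Proof.
rewrite le_eqVlt => /predU1P[->|xy].
  by rewrite subrr set_itv_ge ?measure0// bnd_simp ltxx.
rewrite -law_itvoc ?ltW//.
have -> : `]x, y]%classic = `]x, y[ `|` [set y] :> set R by rewrite setUitv1// bnd_simp.
rewrite measureU//.
- by rewrite [X in (_ + X)%E](P_atomless y) adde0.
by apply/seteqP; split => // z [] /=; rewrite in_itv/= => /andP[_ +] zy; rewrite zy ltxx.
Qed.

Lemma law_itvoy x : P `]x, +oo[%classic = (1 - F x)%:E.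
Proof.
rewrite EFinB fineK ?P_itv_fin// -(probability_setT P).
have -> : [set: R] = `]-oo, x] `|` `]x, +oo[ :> set R.
  by rewrite -itv_bndbnd_setU// set_itvE.
rewrite measureU//; first by rewrite addeAC subee ?add0e// P_itv_fin.
apply/seteqP; split => // z [] /=; rewrite !in_itv/= => zx /andP[+ _].
by rewrite ltNge zx.
Qed.

Lemma law_cdf_ndecr x y : x <= y -> F x <= F y.
Proof.
by move=> xy; rewrite -subr_ge0 -lee_fin -law_itvoc.
Qed.

(** Continuity of the measure from above along closed intervals that shrink to the null set
    [[set x]]. *)
Lemma atomless_small_itv x e : 0 < e ->
  exists2 d : R, 0 < d & (P `[(x - d)%R, (x + d)%R]%classic < e%:E)%E.
Proof.
move=> e0; pose G n := `[x - n.+1%:R^-1, x + n.+1%:R^-1]%classic : set R.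
have mG n : measurable (G n : set (measurableTypeR R)) by exact: measurable_itv.
have GE : \bigcap_n G n = [set x].
  apply/seteqP; split => [y yG|_ -> n _] /=; last first.
    by rewrite /G/= in_itv/= gerBl lerDl !invr_ge0 !ler0n.
  apply/eqP; rewrite -subr_eq0 -normr_le0; apply/ler_addgt0Pl => d d0.
  rewrite addr0; pose n := Num.bound d^-1.
  have := yG n I; rewrite /G/= in_itv/= -ler_distl => /le_trans; apply.
  rewrite -[leRHS]invrK lef_pV2 ?posrE ?invr_gt0//.
  rewrite (@le_trans _ _ n%:R) ?ler_nat//.
  by rewrite ltW// archi_boundP// invr_ge0 ltW.
have : P (G n) @[n --> \oo] --> 0%E.
  rewrite -(P_atomless x) -GE; apply: nonincreasing_cvg_mu => //.
  - by rewrite (le_lt_trans (probability_le1 _ _))// ltry.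
  - exact: bigcap_measurable.
  - move=> m n mn; apply/subsetPset; apply: subset_itv.
    + by rewrite bnd_simp lerD2l lerN2 lef_pV2 ?posrE ?ler_nat.
    + by rewrite bnd_simp lerD2l lef_pV2 ?posrE ?ler_nat.
move=> /fine_cvgP[_ /cvgr_lt/(_ e e0)] [n _ /(_ n (leqnn n))/= ne].
exists n.+1%:R^-1 => //.
by rewrite -[X in (X < _)%E]fineK ?lte_fin// P_itv_fin.
Qed.

Lemma atomless_cdf_continuous x : F y @[y --> x] --> F x.
Proof.
apply/cvgrPdist_lt => e e0; have [d d0 dP] := atomless_small_itv x e e0.
near=> y.
have : `|x - y| < d by near: y; exact: cvgr_dist_lt.
rewrite ltr_distl => /andP[? ?].
have small a b : a <= b -> x - d <= a -> b <= x + d -> F b - F a < e.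
  move=> ab da bd; rewrite -lte_fin -law_itvoc//; apply: le_lt_trans dP.
  apply: le_measure; rewrite ?inE; [exact: measurable_itv|exact: measurable_itv|].
  by move=> z/=; rewrite !in_itv/= => /andP[? ?]; apply/andP; split; lra.
have [xy|yx] := leP x y.
  by rewrite distrC ger0_norm ?subr_ge0 ?law_cdf_ndecr//; apply: small; lra.
by rewrite ger0_norm ?subr_ge0 ?law_cdf_ndecr ?ltW//; apply: small; lra.
Unshelve. all: by end_near. Qed.

End AtomlessLaw.

(** * Weighted quadratic forms and the coercive feedback form *)

Section QuadraticForms.
Context {R : realFieldType} {I : finType}.
Implicit Types (a b p phi x : I -> R).

(** The difference of the two sides is the variance of [x] under the weights [p]. *)
Lemma jensen_sqr p x : (forall i, 0 <= p i) -> \sum_i p i = 1 ->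
  (\sum_i p i * x i) ^+ 2 <= \sum_i p i * x i ^+ 2.
Proof.
move=> p0 p1; set m := \sum_i p i * x i; rewrite -subr_ge0.
have -> : \sum_i p i * x i ^+ 2 - m ^+ 2 = \sum_i p i * (x i - m) ^+ 2.
  rewrite [RHS](eq_bigr (fun i => p i * x i ^+ 2 + (- 2 * m) * (p i * x i) + m ^+ 2 * p i)).
    by rewrite !big_split -!mulr_sumr/= -/m p1; ring.
  by move=> i _; ring.
by apply: sumr_ge0 => i _; rewrite mulr_ge0// sqr_ge0.
Qed.

Lemma sum_sqr_dominated a b : (forall i, 0 < b i) ->
  exists2 K, 0 < K & forall x, \sum_i a i * x i ^+ 2 <= K * \sum_i b i * x i ^+ 2.
Proof.
move=> b0; pose K := 1 + \sum_i `|a i| / b i.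
have S0 : 0 <= \sum_i `|a i| / b i by apply: sumr_ge0 => i _; rewrite divr_ge0// ltW.
exists K => [|x]; first by rewrite ltr_wpDr.
rewrite mulr_sumr; apply: ler_sum => i _; rewrite [leRHS]mulrA ler_wpM2r ?sqr_ge0//.
rewrite -ler_pdivrMr// (@le_trans _ _ (`|a i| / b i))//.
  by rewrite ler_wpM2r ?ler_norm// invr_ge0 ltW.
rewrite /K (bigD1 i)//= addrCA ler_wpDr// addr_ge0// sumr_ge0// => j _.
by rewrite divr_ge0// ltW.
Qed.

(** Cauchy-Schwarz, obtained as Jensen's inequality for the values [a i / p i * x i]. *)
Lemma sqr_sum_dominated a p : (forall i, 0 < p i) -> \sum_i p i = 1 ->
  exists2 K, 0 < K & forall x, (\sum_i a i * x i) ^+ 2 <= K * \sum_i p i * x i ^+ 2.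
Proof.
move=> p0 p1.
have [K K0 KP] := sum_sqr_dominated (fun i => a i ^+ 2 / p i) _ p0.
exists K => // x; apply: le_trans (KP x).
have -> : \sum_i a i * x i = \sum_i p i * (a i / p i * x i).
  by apply: eq_bigr => i _; rewrite mulrA mulrCA divff ?gt_eqF// mulr1.
apply: le_trans (jensen_sqr _ _ _ p1) _ => [i|]; first exact: ltW.
apply: ler_sum => i _; rewrite le_eqVlt; apply/orP; left; apply/eqP.
by have := p0 i; move=> /lt0r_neq0 ?; field.
Qed.

(* With [m = \sum p x] the form is the variance of [x] under [p], plus
   [\sum phi x ^ 2 + (\sum phi x) ^ 2]; the variance controls [x i - m] and the
   term [phi i0 * x i0 ^ 2] pins [m] down. *)
Lemma feedback_form_coercive p phi (i0 : I) :
  (forall i, 0 < p i) -> \sum_i p i = 1 ->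
  (forall i, 0 <= phi i) -> 0 < phi i0 ->
  exists2 c, 0 < c & forall x, c * (\sum_i p i * x i ^+ 2) <=
    \sum_i (p i + phi i) * x i ^+ 2
    - (\sum_i (p i + phi i) * x i) * (\sum_i (p i - phi i) * x i).
Proof.
move=> p0 p1 phi0 phii0.
(* The factor 1/2 gives [2 * b <= p i0] and [2 * b <= phi i0], and [2 (x - m)^2 + 2 x^2 - m^2] is
   the square [(2 x - m)^2]; hence [b * m ^+ 2 <= D]. *)
pose b := Num.min (p i0) (phi i0) / 2.
have b0 : 0 < b by rewrite divr_gt0// lt_min p0.
(* Adding [b * (E - m ^+ 2) <= b * D] and [b * m ^+ 2 <= D] gives [b * E <= (1 + b) * D]. *)
exists (b / (1 + b)) => [|x]; first by rewrite divr_gt0// addr_gt0.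
set m := \sum_i p i * x i; set E := \sum_i p i * x i ^+ 2.
have varE : E - m ^+ 2 = \sum_i p i * (x i - m) ^+ 2.
  rewrite [RHS](eq_bigr (fun i => p i * x i ^+ 2 + (- 2 * m) * (p i * x i) + m ^+ 2 * p i)).
    by rewrite !big_split -!mulr_sumr/= -/m p1 /E; ring.
  by move=> i _; ring.
set D := (X in _ <= X).
have DE : D = (E - m ^+ 2) + \sum_i phi i * x i ^+ 2 + (\sum_i phi i * x i) ^+ 2.
  rewrite /D (eq_bigr (fun i => p i * x i ^+ 2 + phi i * x i ^+ 2)) => [|i _]; last by ring.
  rewrite [\sum_i (p i + _) * _](eq_bigr (fun i => p i * x i + phi i * x i)) => [|i _]; last by ring.
  rewrite [\sum_i (p i - _) * _](eq_bigr (fun i => p i * x i - phi i * x i)) => [|i _]; last by ring.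
  by rewrite !big_split/= sumrN -/m -/E; ring.
have phix i : 0 <= phi i * x i ^+ 2 by rewrite mulr_ge0// sqr_ge0.
have px i : 0 <= p i * (x i - m) ^+ 2 by rewrite mulr_ge0 ?sqr_ge0// ltW.
have Dvar : E - m ^+ 2 <= D by rewrite DE -addrA ler_wpDr// addr_ge0 ?sqr_ge0 ?sumr_ge0.
have Dm : b * m ^+ 2 <= D.
  have : p i0 * (x i0 - m) ^+ 2 + phi i0 * x i0 ^+ 2 <= D.
    rewrite DE varE -[leLHS]addr0 lerD ?sqr_ge0// lerD//.
      by rewrite (bigD1 i0)//= ler_wpDr// sumr_ge0.
    by rewrite (bigD1 i0)//= ler_wpDr// sumr_ge0.
  apply: le_trans.
  have h1 : 2 * b <= p i0 by rewrite /b mulrC divfK// ge_min lexx.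
  have h2 : 2 * b <= phi i0 by rewrite /b mulrC divfK// ge_min lexx orbT.
  apply: (@le_trans _ _ (2 * b * (x i0 - m) ^+ 2 + 2 * b * x i0 ^+ 2)); last first.
    by rewrite lerD// ler_wpM2r// sqr_ge0.
  rewrite -subr_ge0 [leRHS](_ : _ = b * (2 * x i0 - m) ^+ 2); last by ring.
  by rewrite mulr_ge0 ?sqr_ge0// ltW.
rewrite mulrAC ler_pdivrMr ?addr_gt0//.
have : b * (E - m ^+ 2) <= b * D by rewrite ler_pM2l.
by lra.
Qed.

(** Without [e] the sum is minus the coercive form, hence at most [- c * E] with [E] the
    [p]-weighted sum of squares. An error that is small relative to [s] uses up at most half of
    this, because [s ^+ 2] is itself dominated by [E]. *)
Lemma perturbed_feedback_decreasing p phi b (i0 : I) :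
  (forall i, 0 < p i) -> \sum_i p i = 1 ->
  (forall i, 0 <= phi i) -> 0 < phi i0 -> (forall i, 0 < b i) ->
  exists c eta : R, [/\ 0 < c, 0 < eta & forall x (e : I -> R),
    let s := \sum_i (p i + phi i) * x i in
    (forall i, `|e i| <= eta * `|s|) ->
    \sum_i x i * ((p i - phi i) * s + e i - (p i + phi i) * x i)
      <= - c * \sum_i b i * x i ^+ 2].
Proof.
move=> p0 p1 phi0 phii0 b0.
have [c c0 cP] := feedback_form_coercive p phi i0 p0 p1 phi0 phii0.
have [K K0 KP] := sqr_sum_dominated (fun i => p i + phi i) p p0 p1.
have [L L0 LP] := sum_sqr_dominated (fun=> 1) p p0.
have [B B0 BP] := sum_sqr_dominated b p p0.
pose n : R := #|I|%:R.
have n0 : 0 <= n by exact: ler0n.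
have d0 : 0 < L + n * K by rewrite ltr_wpDr// mulr_ge0// ltW.
(* By [|x| |s| <= (x^2 + s^2) / 2] the error terms add up to at most [eta / 2 * (L + n * K) * E],
   which is [c / 2 * E] for this [eta]. Division by [B] passes from the weights [p] to the weights
   [b]. *)
exists (c / (2 * B)), (c / (L + n * K)); split; [by rewrite divr_gt0// mulr_gt0|exact: divr_gt0|].
set eta := c / (L + _) => x e s es.
set E := \sum_i p i * x i ^+ 2.
have eta0 : 0 < eta by exact: divr_gt0.
have xe : \sum_i x i * e i <= c / 2 * E.
  apply: (@le_trans _ _ (\sum_i eta / 2 * (1 * x i ^+ 2 + s ^+ 2))).
    apply: ler_sum => i _; apply: (@le_trans _ _ (`|x i| * (eta * `|s|))).
      by rewrite (le_trans (ler_norm _))// normrM ler_wpM2l.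
    rewrite mul1r -[x i ^+ 2]real_normK ?num_real// -[s ^+ 2]real_normK ?num_real//.
    rewrite -subr_ge0 [leRHS](_ : _ = eta / 2 * (`|x i| - `|s|) ^+ 2); last by field.
    by rewrite mulr_ge0 ?sqr_ge0// divr_ge0// ltW.
  rewrite -mulr_sumr big_split/= sumr_const -[_ *+ #|_|]mulr_natl -/n.
  have -> : c / 2 * E = eta / 2 * (L * E + n * (K * E)).
    by rewrite /eta; field; rewrite gt_eqF.
  rewrite ler_pM2l ?divr_gt0// lerD ?LP// ler_wpM2l//; exact: KP.
have -> : \sum_i x i * ((p i - phi i) * s + e i - (p i + phi i) * x i) =
   \sum_i x i * e i - (\sum_i (p i + phi i) * x i ^+ 2 - s * \sum_i (p i - phi i) * x i).
  rewrite opprB mulr_sumr addrA -!sumrN -!big_split/=.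
  by apply: eq_bigr => i _; ring.
have := cP x; rewrite -/s -/E => cEx.
have : c / (2 * B) * (\sum_i b i * x i ^+ 2) <= c / 2 * E.
  have -> : c / 2 * E = c / (2 * B) * (B * E) by field; rewrite gt_eqF.
  by rewrite ler_pM2l ?BP// divr_gt0// mulr_gt0.
by rewrite mulNr; lra.
Qed.

End QuadraticForms.

(** * Market shares as functions of the workload *)

Section MarketShares.
Context {R : realType} {N : nat} (M : model R N).
Implicit Types (q : 'rV[R]_N) (i : 'I_N) (g W : R).
Local Notation F := (cdf_law M).

Lemma workload_gt0 q : in_orthant q -> 0 < workload M q.
Proof.
case=> q0 qn0; have bq i : 0 <= beta M i * q 0 i by rewrite mulr_ge0// ltW// beta_gt0.
rewrite lt_neqAle sumr_ge0 ?andbT//; apply: contra_neq qn0 => /esym W0.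
apply/rowP => i; rewrite mxE; apply/eqP.
have := psumr_eq0P (fun j _ => bq j) W0; move=> /(_ i isT)/eqP.
by rewrite mulf_eq0 gt_eqF ?beta_gt0.
Qed.

Lemma delayE q j : delay M q j = workload M q * unit_delay M j.
Proof.
case: j => [i|]/=; last by rewrite mulr0.
by congr (_ / _); ring.
Qed.

Definition lower_edge i : R := fine (a_minus M i).

(** When [j] has the smaller rebate, [workload M q * edge i j] is the value of [g] at which [i] and
    [j] have equal utility; above it [i] is preferred. *)
Definition edge i (j : option 'I_N) : R :=
  (r M i - rebate M j)^-1 * (unit_delay M (Some i) - unit_delay M j).

Lemma edge_le_a_minus i j : rebate M j < r M i -> ((edge i j)%:E <= a_minus M i)%E.
Proof. by move=> ji; apply: ereal_sup_ubound; exists j. Qed.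

Lemma unit_delay_gt0 i : 0 < unit_delay M (Some i).
Proof. by rewrite /= invr_gt0 !mulr_gt0 ?mu_gt0 ?beta_gt0 ?v_gt0. Qed.

Lemma r0_lt_r i : rebate M None < r M i.
Proof. by rewrite /= (lt_le_trans (r0_lt0 M))// r_ge0. Qed.

(** The supremum is finite: the index 0 always competes because its rebate is negative, and there
    are only finitely many indices. *)
Lemma a_minusE i : a_minus M i = (lower_edge i)%:E.
Proof.
rewrite /lower_edge fineK// fin_numElt; apply/andP; split.
  by apply: lt_le_trans (edge_le_a_minus _ _ (r0_lt_r i)); exact: ltNyr.
apply: (@le_lt_trans _ _ (\sum_j `|edge i j|)%:E); last exact: ltry.
apply: ge_ereal_sup => _ [j ji <-]; rewrite lee_fin (bigD1 j)//=.
by rewrite (le_trans (ler_norm _))// ler_wpDr// sumr_ge0.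
Qed.

Lemma edge_le i j : rebate M j < r M i -> edge i j <= lower_edge i.
Proof. by move=> /edge_le_a_minus; rewrite a_minusE lee_fin. Qed.

Lemma lower_edge_gt0 i : 0 < lower_edge i.
Proof.
apply: lt_le_trans (edge_le _ _ (r0_lt_r i)).
by rewrite mulr_gt0 ?invr_gt0 ?subr_gt0 ?r0_lt_r//; exact: unit_delay_gt0.
Qed.

Lemma a_plus_le_edge i k : r M i < r M k -> (a_plus M i <= (edge k (Some i))%:E)%E.
Proof. by move=> ik; apply: ereal_inf_lbound; exists k. Qed.

Section Choice.
Variable istar : R -> 'rV[R]_N -> option 'I_N.
Hypothesis istarP : is_best_choice M istar.

Lemma utilityB g q i j : rebate M j < r M i ->
  utility M g q (Some i) - utility M g q j =
    (r M i - rebate M j) * (g - workload M q * edge i j).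
Proof.
rewrite -subr_gt0 => ji; rewrite /utility !delayE /edge mulrBr.
by rewrite [X in _ = _ - X]mulrCA mulVKf ?gt_eqF//=; ring.
Qed.

Lemma utility_le g q i j : rebate M j < r M i ->
  (utility M g q j <= utility M g q (Some i)) = (workload M q * edge i j <= g).
Proof. by move=> ji; rewrite -subr_ge0 utilityB// pmulr_rge0 ?subr_gt0// subr_ge0. Qed.

Lemma utility_lt g q i j : rebate M j < r M i ->
  (utility M g q j < utility M g q (Some i)) = (workload M q * edge i j < g).
Proof. by move=> ji; rewrite -subr_gt0 utilityB// pmulr_rgt0 ?subr_gt0// subr_gt0. Qed.

(** With [between_chosen_by] this confines ties to the two endpoints: whatever the tie-breaking
    rule, the chosen set lies between an open interval and its closure. *)
Lemma chosen_by_between g q i : in_orthant q -> chosen_by istar i q g ->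
  workload M q * lower_edge i <= g /\ ((g / workload M q)%:E <= a_plus M i)%E.
Proof.
move=> qo [g0 gi]; have W0 := workload_gt0 q qo.
have best j : utility M g q j <= utility M g q (Some i) by rewrite -gi; exact: istarP.
split.
  rewrite mulrC -ler_pdivlMr// -lee_fin -a_minusE.
  apply: ge_ereal_sup => _ [j ji <-].
  by rewrite lee_fin ler_pdivlMr// mulrC -utility_le.
apply: le_ereal_inf_tmp => _ [k ik <-]; rewrite lee_fin ler_pdivrMr// mulrC.
by rewrite leNgt -[X in ~~ (X * _ < _)]/(workload M q) -(utility_lt g q k (Some i) ik) -leNgt.
Qed.

(** Strict inequalities exclude every other maximizer: a smaller rebate loses because [g] is above
    its edge, a larger one because [g] is below. *)
Lemma between_chosen_by g q i : in_orthant q ->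
  workload M q * lower_edge i < g -> ((g / workload M q)%:E < a_plus M i)%E ->
  chosen_by istar i q g.
Proof.
move=> qo lo hi; have W0 := workload_gt0 q qo.
have g0 : 0 < g by apply: le_lt_trans lo; rewrite mulr_ge0 ?ltW// lower_edge_gt0.
split=> //; have := istarP g q g0 qo (Some i); case istarE: (istar g q) => [k|]; last first.
  move=> best; have := utility_lt g q i None (r0_lt_r i).
  rewrite ltNge best/= => /esym/negbT/negP[]; apply: le_lt_trans lo.
  by rewrite ler_pM2l// edge_le// r0_lt_r.
have [ki|ik|/(r_inj (m:=M))-> //] := ltgtP (r M k) (r M i) => best.
  have := utility_lt g q i (Some k) ki.
  rewrite ltNge best/= => /esym/negbT/negP[]; apply: le_lt_trans lo.
  by rewrite ler_pM2l// edge_le.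
have := utility_le g q k (Some i) ik.
rewrite best => /esym; rewrite leNgt mulrC -ltr_pdivrMr// -lte_fin => /negP[].
by apply: lt_le_trans hi _; exact: a_plus_le_edge.
Qed.

(** The default 1 is the value of the distribution function at infinity, for [a_plus M i = +oo];
    under [assumption_iv] the value [-oo] cannot occur. *)
Definition upper_cdf i W : R := if a_plus M i is a%:E then F (W * a) else 1.

Definition share i W : R := upper_cdf i W - F (W * lower_edge i).

(** Arbitrary tie-breaking leaves the measurability of [A] to be shown. It holds because [A] is [S]
    plus at most two points, and these points are null by atomlessness. *)
Lemma null_endpoints (S A : set (measurableTypeR R)) (a b : R) :
  measurable S -> S `<=` A -> A `<=` S `|` [set a] `|` [set b] -> law M A = law M S.
Proof.
move=> mS SA ASab.
have null1 (x : R) : measurable ([set x] : set (measurableTypeR R)) by exact: measurable_set1.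
have mI (x : R) : measurable (A `&` [set x] : set (measurableTypeR R)).
  have [Ax|nAx] := pselect (A x).
    by rewrite (_ : _ `&` _ = [set x])//; apply/seteqP; split=> [y []//|y ->].
  by rewrite (_ : _ `&` _ = set0)//; apply/seteqP; split=> [y [+ yx]|//]; rewrite yx.
have mSa : measurable (S `|` [set a]) by exact: measurableU mS (null1 a).
have mA : measurable A.
  rewrite (_ : A = S `|` (A `&` [set a]) `|` (A `&` [set b])).
    by apply: measurableU => //; exact: measurableU.
  apply/seteqP; split=> [y Ay|y [[/SA//|[]//]|[]//]].
  by have [[|]|] := ASab y Ay; [left; left|left; right|right].
apply/eqP; rewrite eq_le; apply/andP; split; last by rewrite le_measure ?inE.
apply: (@le_trans _ _ (law M (S `|` [set a] `|` [set b]))).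
  by rewrite le_measure ?inE//; exact: measurableU mSa (null1 b).
apply: (@le_trans _ _ (law M (S `|` [set a]) + law M [set b])%E).
  by apply: measureU2 => //; exact: null1.
rewrite law_atomless adde0 (le_trans (measureU2 _ _ _))//.
by rewrite [X in (_ + X)%E](law_atomless M a) adde0.
Qed.

(** The sandwich reduces the chosen set to an open interval up to null endpoints. [assumption_iv]
    puts the endpoints in order, so that its law is a difference of distribution functions. *)
Lemma chiE i q : assumption_iv M -> in_orthant q ->
  chi M istar i q = share i (workload M q).
Proof.
move=> /(_ i) le_edges qo; have W0 := workload_gt0 q qo.
rewrite /chi /share /upper_cdf; move: le_edges; rewrite a_minusE.
case a_plusE: (a_plus M i) => [a| |] //; rewrite ?lee_fin => le_edges.
  rewrite (null_endpoints `]workload M q * lower_edge i, workload M q * a[%classic _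
    (workload M q * lower_edge i) (workload M q * a)); first last.
  - move=> g /(chosen_by_between g q i qo)[]; rewrite a_plusE lee_fin ler_pdivrMr// [a * _]mulrC.
    rewrite !le_eqVlt => /predU1P[->|lo]; first by left; right.
    by move=> /predU1P[->|hi]; [right|left; left; rewrite /= in_itv/= lo].
  - move=> g; rewrite /= in_itv/= => /andP[lo hi]; apply: between_chosen_by => //.
    by rewrite a_plusE lte_fin ltr_pdivrMr// mulrC.
  - exact: measurable_itv.
  by rewrite (law_itvoo _ (law_atomless M))// ler_pM2l.
(* Here the interval is unbounded and has one endpoint only; the second exceptional point 0 is a
   dummy. *)
rewrite (null_endpoints `]workload M q * lower_edge i, +oo[%classic _
  (workload M q * lower_edge i) 0); first last.
- move=> g /(chosen_by_between g q i qo)[]; rewrite le_eqVlt.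
  by move=> /predU1P[->|lo _]; left; [right|left; rewrite /= in_itv/= lo].
- move=> g; rewrite /= in_itv/= andbT => lo; apply: between_chosen_by => //.
  by rewrite a_plusE ltry.
- exact: measurable_itv.
by rewrite law_itvoy.
Qed.

End Choice.
End MarketShares.

(** * Regularity of an integral as a function of its upper limit *)

Section IntegralFunction.
Context {R : realType} (h : R -> R).
Implicit Types t : R.
Hypothesis h_int : forall t : R, 0 <= t ->
  lebesgue_measure.-integrable `[0, t] (fun s => (h s)%:E).
Let I (t : R) : R := \int[lebesgue_measure]_(s in `[0, t]) h s.

Lemma integral_function0 : I 0 = 0.
Proof. by rewrite /I set_itv1 Rintegral_set1. Qed.

Lemma integral_function_cvg t : 0 < t -> I x @[x --> t] --> I t.
Proof.
move=> t0; have T0 : 0 < t + 1 by rewrite addr_gt0.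
have := parameterized_integral_continuous (ltW T0) (h_int _ (ltW T0)).
move/(continuous_within_itvP _ T0) => [+ _ _]; apply.
by rewrite in_itv/= t0 ltrDl ltr01.
Qed.

Lemma integral_function_cvg0 : I x @[x --> 0^'+] --> (0 : R).
Proof.
have := parameterized_integral_continuous (ltW ltr01) (h_int _ (ltW ltr01)).
move/(continuous_within_itvP _ ltr01) => [_ + _].
by rewrite /parameterized_integral -/(I 0) integral_function0.
Qed.

Lemma integral_function_is_derive t : 0 < t -> h x @[x --> t] --> h t ->
  is_derive t (1 : R) I (h t).
Proof.
move=> t0 ht; have tT : t < t + 1 by rewrite ltrDl.
have [dI dIE] := continuous_FTC1_closed tT (h_int _ (ltW (lt_trans t0 tT))) t0 ht.
by apply: (DeriveDef dI); rewrite -derive1E.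
Qed.

End IntegralFunction.

(** * Continuity and differentiability of fluid trajectories *)

Section FluidTrajectory.
Context {R : realType} {N : nat} (M : model R N).
Implicit Types (q : 'rV[R]_N) (i : 'I_N) (t W : R).

Lemma share_cvg i W : share M i w @[w --> W] --> share M i W.
Proof.
have Fc (a : R) : cdf_law M (w * a) @[w --> W] --> cdf_law M (W * a).
  apply: (@cvg_comp _ _ _ ( *%R^~ a) (cdf_law M) _ (nbhs (W * a))).
    by apply: cvgMl; exact: cvg_id.
  exact: atomless_cdf_continuous (law_atomless M) _.
apply: cvgB (Fc _); rewrite /upper_cdf.
by case: (a_plus M i) => [a| |]; [exact: Fc|exact: cvg_cst|exact: cvg_cst].
Qed.

Variable istar : R -> 'rV[R]_N -> option 'I_N.
Hypothesis istarP : is_best_choice M istar.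
Hypothesis M_iv : assumption_iv M.
Variables (Q0 : 'rV[R]_N) (Q : R -> 'rV[R]_N).
Hypothesis Q_fluid : is_fluid_solution M istar Q0 Q.

Let inflow i W := bd M i * lambda M i + bo M * Lambda M * share M i W.

Let Ichi i t := \int[lebesgue_measure]_(s in `[0, t]) chi M istar i (Q s).
Let Iservice i t := \int[lebesgue_measure]_(s in `[0, t]) service M i (Q s).

Let flow i t := Q0 0 i + bd M i * lambda M i * t + bo M * Lambda M * Ichi i t
  - v M * Iservice i t.

Let QE i t : 0 <= t -> Q t 0 i = flow i t.
Proof. by move=> t0; have [_ /(_ i)[_ _ ->]] := Q_fluid t t0. Qed.

Let chi_int i t : 0 <= t ->
  lebesgue_measure.-integrable `[0, t] (fun s => (chi M istar i (Q s))%:E).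
Proof. by move=> t0; have [_ /(_ i)[]] := Q_fluid t t0. Qed.

Let service_int i t : 0 <= t ->
  lebesgue_measure.-integrable `[0, t] (fun s => (service M i (Q s))%:E).
Proof. by move=> t0; have [_ /(_ i)[]] := Q_fluid t t0. Qed.

Lemma fluid0 : Q 0 = Q0.
Proof.
apply/rowP => i; rewrite QE// /flow /Ichi /Iservice.
by rewrite !integral_function0 !mulr0 addr0 subr0 addr0.
Qed.

Let flow_cvg (G : set_system R) (FG : Filter G) i t (c s : R) :
  x @[x --> G] --> t -> Ichi i x @[x --> G] --> c -> Iservice i x @[x --> G] --> s ->
  flow i x @[x --> G] --> Q0 0 i + bd M i * lambda M i * t + bo M * Lambda M * c - v M * s.
Proof.
move=> Gt Gc Gs; apply: cvgB; last exact: cvgMr.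
apply: cvgD; last exact: cvgMr.
by apply: cvgD; [exact: cvg_cst|exact: cvgMr].
Qed.

Lemma fluid_cvg0 i : Q t 0 i @[t --> (0 : R)^'+] --> Q 0 0 i.
Proof.
rewrite fluid0; apply: (@cvg_trans _ (flow i t @[t --> (0 : R)^'+])).
  by apply: near_eq_cvg; near=> t; rewrite QE.
have -> : Q0 0 i = Q0 0 i + bd M i * lambda M i * 0 + bo M * Lambda M * 0 - v M * 0.
  by rewrite !mulr0 !addr0 subr0.
apply: flow_cvg; first by apply: cvg_at_right_filter; exact: cvg_id.
- exact: (integral_function_cvg0 _ (chi_int i)).
- exact: (integral_function_cvg0 _ (service_int i)).
Unshelve. all: by end_near. Qed.

Let near_flow i t : 0 < t -> \forall s \near t, flow i s = Q s 0 i.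
Proof.
move=> t0; near=> s; rewrite QE//.
by apply: ltW; near: s; exact: lt_nbhsr.
Unshelve. all: by end_near. Qed.

Lemma fluid_cvg i t : 0 < t -> Q s 0 i @[s --> t] --> Q t 0 i.
Proof.
move=> t0; rewrite (QE i t (ltW t0)).
apply: cvg_trans; first by apply: near_eq_cvg; exact: near_flow.
apply: flow_cvg; first exact: cvg_id.
- exact: (integral_function_cvg _ (chi_int i)).
- exact: (integral_function_cvg _ (service_int i)).
Qed.

Lemma fluid_workload_cvg t : 0 < t -> workload M (Q s) @[s --> t] --> workload M (Q t).
Proof.
move=> t0; rewrite /workload; apply: cvg_big => [|i _]; first exact: add_continuous.
by apply: cvgMr; exact: fluid_cvg.
Qed.

(** A bootstrap: the integral equation makes [Q] continuous, so the integrands are continuous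
    through [share_cvg], and the fundamental theorem of calculus applies. *)
Lemma fluid_is_derive i t : 0 < t ->
  is_derive t (1 : R) (fun s => Q s 0 i)
    (bd M i * lambda M i + bo M * Lambda M * share M i (workload M (Q t))
      - v M * service M i (Q t)).
Proof.
move=> t0; have [Qt _] := Q_fluid t (ltW t0).
have W0 := workload_gt0 M _ Qt.
have chic : chi M istar i (Q s) @[s --> t] --> chi M istar i (Q t).
  rewrite (chiE _ _ istarP)//.
  apply: (@cvg_trans _ (share M i (workload M (Q s)) @[s --> t])).
    apply: near_eq_cvg; near=> s; rewrite (chiE _ _ istarP)//.
    have s0 : 0 <= s by apply: ltW; near: s; exact: lt_nbhsr.
    by have [] := Q_fluid s s0.
  apply: (@cvg_comp _ _ _ (fun s => workload M (Q s)) (share M i)).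
    exact: fluid_workload_cvg.
  exact: share_cvg.
have servc : service M i (Q s) @[s --> t] --> service M i (Q t).
  apply: cvgM; first by apply: cvgMr; apply: cvgMr; exact: fluid_cvg.
  by apply: cvgV; [rewrite gt_eqF|exact: fluid_workload_cvg].
have dchi := integral_function_is_derive _ (chi_int i) t t0 chic.
have dserv := integral_function_is_derive _ (service_int i) t t0 servc.
have := near_flow i t t0; rewrite -(chiE _ _ istarP)// => /near_eq_is_derive; apply.
have -> : flow i = cst (Q0 0 i) + (bd M i * lambda M i) \*: id
    + (bo M * Lambda M) \*: Ichi i - v M \*: Iservice i by apply/funext => s.
have d1 : is_derive t (1 : R) (cst (Q0 0 i) + (bd M i * lambda M i) \*: id)
    (0 + (bd M i * lambda M i) *: 1).
  by apply: is_deriveD; exact: is_deriveZ.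
have d2 := is_deriveD d1 (is_deriveZ (bo M * Lambda M) dchi).
have d3 := is_deriveB d2 (is_deriveZ (v M) dserv).
by move: d3; rewrite add0r [_%:A]mulr1.
Unshelve. all: by end_near. Qed.

End FluidTrajectory.

(** * A Lyapunov criterion for weighted squared distances *)

Section LyapunovCriterion.
Context {R : realType} {N : nat} (M : model R N).
Variable istar : R -> 'rV[R]_N -> option 'I_N.
Hypothesis istarP : is_best_choice M istar.
Hypothesis M_iv : assumption_iv M.
Implicit Types (q z : 'rV[R]_N) (i : 'I_N).

Definition inflow i (W : R) : R :=
  bd M i * lambda M i + bo M * Lambda M * share M i W.

Definition drift i z : R := inflow i (workload M z) - v M * service M i z.

Lemma coord_le_norm z i : `|z 0 i| <= `|z|.
Proof.
rewrite [`|z|]mx_normrE.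
exact: (@le_bigmax _ _ _ _ (fun ij => `|z ij.1 ij.2|) (0, i)).
Qed.

Lemma norm_lt_coord z (e : R) : 0 < e -> (forall i, `|z 0 i| < e) -> `|z| < e.
Proof.
move=> e0 ze; rewrite [`|z|]mx_normrE; apply: bigmax_lt => // -[i j] _ /=.
by rewrite ord1.
Qed.

Section WeightedSquare.
Variables (b : 'I_N -> R) (q : 'rV[R]_N).
Hypothesis b_gt0 : forall i, 0 < b i.
Let V z := \sum_i b i * (z 0 i - q 0 i) ^+ 2.

Let V_ge0 z : 0 <= V z.
Proof. by apply: sumr_ge0 => i _; rewrite mulr_ge0 ?sqr_ge0// ltW. Qed.

Let V_small (U : R) : 0 < U ->
  exists2 eps : R, 0 < eps & forall z, `|z - q| < eps -> V z < U.
Proof.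
move=> U0; pose B := \sum_i b i.
have B0 : 0 <= B by apply: sumr_ge0 => i _; exact: ltW.
have B1 : 0 < B + 1 by rewrite ltr_wpDl.
(* A radius at most 1 gives [eps ^+ 2 <= eps <= U / (B + 1)], so that [V z] is at most
   [B * (U / (B + 1)) < U]. *)
exists (Num.min 1 (U / (B + 1))) => [|z]; first by rewrite lt_min ltr01 divr_gt0.
set eps := Num.min _ _ => /ltW zq.
have eps1 : eps <= 1 by rewrite ge_min lexx.
have epsU : eps <= U / (B + 1) by rewrite ge_min lexx orbT.
have eps0 : 0 <= eps by apply: le_trans zq.
apply: (@le_lt_trans _ _ (B * (U / (B + 1)))); last first.
  by rewrite mulrCA gtr_pMr// ltr_pdivrMr// mul1r ltrDl.
rewrite /V mulr_suml; apply: ler_sum => i _; rewrite ler_pM2l//.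
apply: le_trans epsU; apply: (@le_trans _ _ (eps ^+ 2)); last first.
  by rewrite expr2 ler_piMl.
rewrite -real_normK ?num_real// ler_sqr ?nnegrE//.
by apply: le_trans zq; have := coord_le_norm (z - q) i; rewrite !mxE.
Qed.

Let V_cvg (Q : R -> 'rV[R]_N) :
  V (Q t) @[t --> +oo] --> (0 : R) -> Q t @[t --> +oo] --> q.
Proof.
move=> VQ; apply/cvgrPdist_lt => e e0.
have near_coord i : \forall t \near +oo%R, `|q 0 i - Q t 0 i| < e.
  have : 0 < b i * e ^+ 2 by rewrite mulr_gt0 ?exprn_gt0.
  move=> /(cvgr_lt _ VQ); apply: filterS => t VQt.
  rewrite distrC -ltr_sqr ?nnegrE ?(ltW e0)// real_normK ?num_real//.
  rewrite -(ltr_pM2l (b_gt0 i)); apply: le_lt_trans VQt.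
  rewrite /V (bigD1 i)//= ler_wpDr// sumr_ge0// => j _.
  by rewrite mulr_ge0 ?sqr_ge0// ltW.
have nearQ : \forall t \near +oo%R, forall i, `|q 0 i - Q t 0 i| < e.
  exact: filter_forall.
apply: filterS nearQ => t qQ.
by apply: norm_lt_coord => // i; rewrite !mxE.
Qed.

(** Along a trajectory the derivative of [V] is twice the sum in the hypothesis, so [decay_to_zero]
    applies; a trajectory that starts in the sublevel set [V < U] remains in it. *)
Lemma lyapunov_criterion (U : R) : 0 < U ->
  (forall e, 0 < e -> exists2 c : R, 0 < c & forall z, in_orthant z ->
    e <= V z -> V z < U -> \sum_i b i * (z 0 i - q 0 i) * drift i z <= - c) ->
  exists eps : R, 0 < eps /\
    forall (Q0 : 'rV[R]_N) (Q : R -> 'rV[R]_N),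
      in_orthant Q0 -> `|Q0 - q| < eps -> is_fluid_solution M istar Q0 Q ->
      Q t @[t --> +oo] --> q.
Proof.
move=> U0 decr; have [eps eps0 epsP] := V_small U U0.
exists eps; split=> // Q0 Q _ /epsP VQ0 Qsol; apply: V_cvg.
pose V' t := \sum_i 2 * (b i * (Q t 0 i - q 0 i) * drift i (Q t)).
apply: (decay_to_zero (fun t => V (Q t)) V' U) => [|t t0|t t0||e e0].
- apply: cvg_big => [|i _]; first exact: add_continuous.
  have c : Q t 0 i - q 0 i @[t --> (0 : R)^'+] --> Q 0 0 i - q 0 i.
    by apply: cvgB (fluid_cvg0 M istar Q0 Q Qsol i) _; exact: cvg_cst.
  by apply: cvgMr; apply: cvgM; exact: c.
- rewrite (_ : (fun s => V (Q s)) =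
     \sum_i (b i \*: ((fun s => Q s 0 i) - cst (q 0 i)) ^+ 2)); last first.
    by apply/funext => s; rewrite fct_sumE.
  apply: is_derive_sum => i.
  have d := is_deriveB (fluid_is_derive M istar istarP M_iv Q0 Q Qsol i t t0)
    (is_derive_cst (q 0 i) t 1).
  have dZ := is_deriveZ (b i) (is_deriveX 2 d).
  apply: (is_derive_eq dZ).
  rewrite subr0 -[LHS]/(b i * (2 * (Q t 0 i - q 0 i) * drift i (Q t))); ring.
- exact: V_ge0.
- by rewrite (fluid0 M istar Q0 Q Qsol).
- have [c c0 cP] := decr e e0; exists (2 * c); first exact: mulr_gt0.
  move=> t t0 eV VU; rewrite -mulrN /V' -mulr_sumr ler_pM2l//.
  by apply: cP => //; have [] := Qsol t (ltW t0).
Qed.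

End WeightedSquare.
End LyapunovCriterion.

(** * Linearisation at the equilibrium and the Lyapunov function *)

Lemma is_derive_linear_approx {R : realType} (u : R -> R) (t l e : R) :
  is_derive t (1 : R) u l -> 0 < e ->
  \forall x \near t, `|u x - u t - l * (x - t)| <= e * `|x - t|.
Proof.
move=> [ut <-] e0.
have : h^-1 *: (u (h *: 1 + t) - u t) @[h --> 0^'] --> 'D_1 u t := ut.
move=> /cvgrPdist_le/(_ e e0)/nbhs_ballP[d /= d0 dP].
apply/nbhs_ballP; exists d => // x /= xd.
have [->|xt] := eqVneq x t; first by rewrite !subrr mulr0 subr0 normr0 mulr0.
have xt0 : x - t != 0 by rewrite subr_eq0.
have xtd : ball 0 d (x - t) by rewrite /ball/= sub0r normrN distrC.
have := dP _ xtd xt0; rewrite [_%:A]mulr1 subrK => le_e.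
rewrite -[u x - u t](divfK xt0) -mulrBl normrM ler_wpM2r//.
by rewrite distrC [_ / _]mulrC.
Qed.

Section EquilibriumStability.
Context {R : realType} {N : nat} (M : model R N).
Variable istar : R -> 'rV[R]_N -> option 'I_N.
Hypothesis istarP : is_best_choice M istar.
Hypothesis M_iv : assumption_iv M.
Variable q : 'rV[R]_N.
Hypothesis q_eq : is_equilibrium M istar q.

Let Ws := workload M q.
Let m := v M * mu M.
Let p (i : 'I_N) := beta M i * q 0 i / Ws.

Let Ws_gt0 : 0 < Ws. Proof. exact: workload_gt0 q_eq.1. Qed.
Let m_gt0 : 0 < m. Proof. by rewrite mulr_gt0 ?v_gt0 ?mu_gt0. Qed.

Lemma equilibrium_inflow i : inflow M i Ws = m * p i.
Proof.
have := q_eq.2 i; rewrite (chiE M istar istarP)//; last exact: q_eq.1.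
by move/subr0_eq; rewrite /inflow -/Ws => ->; rewrite /service -/Ws /m /p; ring.
Qed.

(** The dedicated inflow [bd M i * lambda M i] is positive, and at equilibrium service must balance
    it. *)
Lemma equilibrium_share_gt0 i : 0 < p i.
Proof.
rewrite -(pmulr_rgt0 _ m_gt0) -equilibrium_inflow /inflow.
rewrite -(chiE M istar istarP)//; last exact: q_eq.1.
rewrite ltr_wpDr ?mulr_gt0 ?bd_gt0 ?lambda_gt0//.
by rewrite !mulr_ge0 ?fine_ge0// ltW ?bo_gt0 ?Lambda_gt0.
Qed.

Lemma equilibrium_share_sum1 : \sum_i p i = 1.
Proof. by rewrite -mulr_suml divff// gt_eqF. Qed.

(* In terms of [x i = beta i * (z i - q i) / (p i + phi i)] and
   [s = W z - W q = \sum (p + phi) x], the drift of [z i] is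
   [m / W z * ((p i - phi i) * s + o(s) - (p i + phi i) * x i)]. *)
Lemma equilibrium_stable (D : 'I_N -> R) (i0 : 'I_N) :
  (forall i, is_derive Ws (1 : R) (share M i) (- D i / Ws)) ->
  (forall i, 0 <= D i) -> 0 < D i0 ->
  exists eps : R, 0 < eps /\
    forall (Q0 : 'rV[R]_N) (Q : R -> 'rV[R]_N),
      in_orthant Q0 -> `|Q0 - q| < eps -> is_fluid_solution M istar Q0 Q ->
      Q t @[t --> +oo] --> q.
Proof.
move=> dD D0 Di0.
have boLa : 0 < bo M * Lambda M by apply: mulr_gt0; [exact: bo_gt0|exact: Lambda_gt0].
pose phi i := bo M * Lambda M * D i / m.
have phi0 i : 0 <= phi i by exact: divr_ge0 (mulr_ge0 (ltW boLa) (D0 i)) (ltW m_gt0).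
have phii0 : 0 < phi i0 by rewrite divr_gt0//; exact: mulr_gt0.
have w0 i : 0 < p i + phi i by rewrite ltr_wpDr// equilibrium_share_gt0.
have b0 i : 0 < (p i + phi i) / beta M i by rewrite divr_gt0// beta_gt0.
have [c [eta [c0 eta0 decr]]] := perturbed_feedback_decreasing p phi _ i0
  equilibrium_share_gt0 equilibrium_share_sum1 phi0 phii0 b0.
have [K1 K10 K1P] := sqr_sum_dominated (fun i => p i + phi i) p
  equilibrium_share_gt0 equilibrium_share_sum1.
have [K2 K20 K2P] := sum_sqr_dominated p (fun i => (p i + phi i) / beta M i) b0.
(* The drift equals [m / W * (G i W - beta M i * z 0 i)]. Pulling out [1 / W] leaves a term linear
   in [z], so only the scalar function [G i] has to be linearised. *)
pose G i W := W * inflow M i W / m.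
have GWs i : G i Ws = Ws * p i by rewrite /G equilibrium_inflow; field; rewrite gt_eqF.
have dG i : is_derive Ws (1 : R) (G i) (p i - phi i).
  have d1 := is_deriveZ (bo M * Lambda M) (dD i).
  have d2 := is_deriveD (is_derive_cst (bd M i * lambda M i) Ws 1) d1.
  have d3 := is_deriveZ m^-1 (is_deriveM (is_derive_id Ws 1) d2).
  have -> : G i = m^-1 \*: (id * (cst (bd M i * lambda M i)
      + (bo M * Lambda M) \*: share M i)).
    by apply/funext => W; rewrite /G mulrC.
  apply: (is_derive_eq d3); rewrite -[LHS]/(m^-1 * (Ws * (0 + bo M * Lambda M * (- D i / Ws))
    + inflow M i Ws * 1)) equilibrium_inflow /phi.
  by field; rewrite !gt_eqF.
have : \forall W \near Ws, forall i,
    `|G i W - G i Ws - (p i - phi i) * (W - Ws)| <= eta * `|W - Ws|.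
  exact: (filter_forall _ (fun i => is_derive_linear_approx _ _ _ _ (dG i) eta0)).
move=> /nbhs_ballP[rho /= rho0 rhoP].
(* This level confines the workload to the ball where the linearisation holds:
   [(W - Ws) ^+ 2 <= K1 * K2 * V < rho ^+ 2]. *)
have U0 : 0 < rho ^+ 2 / (K1 * K2) by rewrite divr_gt0 ?exprn_gt0// mulr_gt0.
apply: (lyapunov_criterion M istar istarP M_iv (fun i => beta M i / (p i + phi i)) q _ _ U0).
  by move=> i /=; rewrite divr_gt0// beta_gt0.
(* In the sublevel set [W < Ws + rho], so the time-change factor [m / W] is at least
   [m / (Ws + rho)]. *)
move=> e e0; exists (m / (Ws + rho) * (c * e)).
  by rewrite mulr_gt0 ?(mulr_gt0 c0 e0)// divr_gt0// addr_gt0.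
move=> z zo eV VU; set W := workload M z; have W0 : 0 < W by exact: workload_gt0.
pose x i := beta M i * (z 0 i - q 0 i) / (p i + phi i).
have VE : \sum_i beta M i / (p i + phi i) * (z 0 i - q 0 i) ^+ 2 =
    \sum_i (p i + phi i) / beta M i * x i ^+ 2.
  apply: eq_bigr => i _; rewrite /x; field.
  by rewrite !gt_eqF// beta_gt0.
rewrite VE in eV VU.
have sE : \sum_i (p i + phi i) * x i = W - Ws.
  rewrite /W /Ws /workload -sumrB; apply: eq_bigr => i _.
  by rewrite /x mulrC divfK ?gt_eqF// mulrBr.
have Wrho : `|W - Ws| < rho.
  rewrite -ltr_sqr ?nnegrE ?(ltW rho0)// real_normK ?num_real// -sE.
  apply: le_lt_trans (K1P x) _; rewrite -ltr_pdivlMl//.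
  apply: le_lt_trans (K2P x) _; rewrite -ltr_pdivlMl//.
  by apply: lt_le_trans VU _; rewrite le_eqVlt; apply/orP; left; apply/eqP; field; rewrite !gt_eqF.
pose err i := G i W - G i Ws - (p i - phi i) * (W - Ws).
have errP i : `|err i| <= eta * `|\sum_i (p i + phi i) * x i|.
  by rewrite sE; apply: rhoP; rewrite /ball/= distrC.
have driftE i : beta M i / (p i + phi i) * (z 0 i - q 0 i) * drift M i z =
    m / W * (x i * ((p i - phi i) * (\sum_i (p i + phi i) * x i) + err i - (p i + phi i) * x i)).
  have -> : drift M i z = m / W * (G i W - beta M i * z 0 i).
    rewrite /drift /service -/W /G /m; field.
    by rewrite !gt_eqF ?v_gt0 ?mu_gt0.
  have -> : beta M i / (p i + phi i) * (z 0 i - q 0 i) = x i by rewrite /x mulrAC.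
  have -> : beta M i * z 0 i = (p i + phi i) * x i + Ws * p i.
    rewrite /x [(p i + phi i) * _]mulrC divfK ?gt_eqF// /p [Ws * _]mulrC divfK ?gt_eqF//; ring.
  by rewrite sE /err GWs; ring.
under eq_bigr do rewrite driftE.
rewrite -mulr_sumr.
have le1 := decr x err errP.
have le2 : c * e <= c * (\sum_i (p i + phi i) / beta M i * x i ^+ 2) by rewrite ler_pM2l.
apply: (@le_trans _ _ (m / W * - (c * e))).
  by rewrite ler_pM2l ?divr_gt0//; apply: le_trans le1 _; rewrite mulNr lerN2.
rewrite mulrN lerN2 ler_pM2r ?mulr_gt0// ler_pM2l// lef_pV2 ?posrE ?addr_gt0//.
by move: Wrho; rewrite ltr_norml => /andP[_ +]; rewrite ltrBlDl => /ltW.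
Qed.

End EquilibriumStability.

(** * Slopes of the market shares at the equilibrium workload *)

Section SeveralClasses.
Context {R : realType} {N : nat} (M : model R N).
Hypothesis M_iv : assumption_iv M.
Implicit Types (i j : 'I_N).

(** By (iv), [0 < lower_edge M i <= edge j (Some i)], so the class with the larger rebate must have
    the larger unit delay. *)
Lemma beta_decreasing i j : r M i < r M j -> beta M j < beta M i.
Proof.
move=> ij; have := M_iv i; rewrite a_minusE => /le_trans/(_ (a_plus_le_edge M i j ij)).
rewrite lee_fin => /(lt_le_trans (lower_edge_gt0 M i)).
rewrite pmulr_rgt0 ?invr_gt0 ?subr_gt0//= ltf_pV2 ?posrE ?mulr_gt0 ?mu_gt0 ?beta_gt0 ?v_gt0//.
by rewrite ltr_pM2r ?v_gt0// ltr_pM2l ?mu_gt0.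
Qed.

Lemma beta_min_le i : beta_min M <= beta M i.
Proof. by apply: ge_inf; [exists 0 => _ [j _ <-]; rewrite ltW ?beta_gt0|exists i]. Qed.

Lemma beta_le_max i : beta M i <= beta_max M.
Proof.
apply: ub_le_sup; last by exists i.
exists (\sum_k beta M k) => _ [j _ <-].
by rewrite (bigD1 j)//= ler_wpDr// sumr_ge0// => k _; rewrite ltW ?beta_gt0.
Qed.

(** Two classes have different rebates, hence different weights, so the factor [beta_min / beta_max]
    is strictly below 1. *)
Lemma kappa_bounds (qhat q : 'rV[R]_N) : (1 < N)%N ->
  0 <= workload M qhat -> 0 < workload M q -> 0 <= kappa M qhat q < workload M q.
Proof.
move=> N1 What W0; pose i0 := Ordinal (ltnW N1); pose i1 := Ordinal N1.
have [i [j ij]] : exists i j, r M i < r M j.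
  by case: (ltgtP (r M i0) (r M i1)) => [|| /(@r_inj _ _ M)//]; do 2!eexists; eassumption.
have lt_bminmax : beta_min M < beta_max M.
  by rewrite (le_lt_trans (beta_min_le j))// (lt_le_trans (beta_decreasing _ _ ij))// beta_le_max.
have bmin0 : 0 <= beta_min M.
  apply: lb_le_inf; first by exists (beta M i), i.
  by move=> _ [k _ <-]; rewrite ltW ?beta_gt0.
have bmax0 : 0 < beta_max M by apply: le_lt_trans lt_bminmax.
rewrite /kappa; apply/andP; split.
  by rewrite !mulr_ge0 ?invr_ge0 ?(ltW bmax0)// le_min What ltW.
apply: (@le_lt_trans _ _ (beta_min M / beta_max M * workload M q)).
  by rewrite ler_wpM2l ?ge_min ?lexx ?orbT// divr_ge0// ltW.
by rewrite gtr_pMl// ltr_pdivrMr// mul1r.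
Qed.

Lemma exists_top_rebate : (0 < N)%N -> exists i, a_plus M i = +oo%E.
Proof.
move=> N0; pose i0 := Ordinal N0.
case: (@arg_maxP _ _ _ i0 xpredT (r M) isT) => i _ imax.
exists i; rewrite /a_plus (_ : [set j | _] = set0) ?image_set0 ?ereal_inf0//.
apply/seteqP; split=> // j /=; rewrite ltNge => /negP; apply; exact: imax.
Qed.

Variables (f : R -> R) (qhat q : 'rV[R]_N).
Hypothesis M_i : assumption_i M f qhat q.
Let Ws := workload M q.
Hypothesis Ws_gt0 : 0 < Ws.
Hypothesis kappaP : 0 <= kappa M qhat q < Ws.
Let threshold := (a_minus_min M * (kappa M qhat q)%:E)%E.

(** Minus [Ws] times the derivative of the share at [Ws], written through the values of [x f(x)] at
    the two edges so that (i) decides its sign. An infinite upper edge contributes 0. *)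
Definition share_slope i : R :=
  Ws * lower_edge M i * f (Ws * lower_edge M i)
  - (if a_plus M i is a%:E then Ws * a * f (Ws * a) else 0).

(** The strict inequality comes from [kappa < Ws]; it places both edges at workload [Ws] where (i)
    provides differentiability and monotonicity. *)
Lemma threshold_lt i (a : R) : lower_edge M i <= a -> (threshold < (Ws * a)%:E)%E.
Proof.
move=> la; apply: (@le_lt_trans _ _ (lower_edge M i * kappa M qhat q)%:E).
  have /andP[k0 _] := kappaP; rewrite EFinM; apply: lee_wpmul2r; first by rewrite lee_fin.
  by rewrite -a_minusE; apply: ereal_inf_lbound; exists i.
have /andP[_ kW] := kappaP.
rewrite lte_fin [ltRHS]mulrC (@lt_le_trans _ _ (lower_edge M i * Ws))//.
  by rewrite ltr_pM2l ?lower_edge_gt0.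
by rewrite ler_pM2r.
Qed.

Lemma share_is_derive i : is_derive Ws (1 : R) (share M i) (- share_slope i / Ws).
Proof.
have [_ dF _] := M_i.
have dFa (a : R) : lower_edge M i <= a ->
    is_derive Ws (1 : R) (fun w => cdf_law M (w * a)) (f (Ws * a) * a).
  move=> la.
  have da : is_derive Ws (1 : R) (fun w : R => w * a) a.
    have := is_deriveZ a (is_derive_id Ws (1 : R)).
    rewrite [_%:A]mulr1; rewrite (_ : a \*: id = fun w : R => w * a)//.
    by apply/funext => w; rewrite mulrC.
  exact: (@is_derive1_comp _ _ (fun w => w * a) Ws _ _ (dF _ (threshold_lt i a la)) da).
have dl := dFa _ (lexx _).
have := M_iv i; rewrite a_minusE.
rewrite /share_slope /share /upper_cdf; case: (a_plus M i) => [a| |]//.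
  rewrite lee_fin => la; apply: (is_derive_eq (is_deriveB (dFa _ la) dl)).
  by field; rewrite gt_eqF.
move=> _; apply: (is_derive_eq (is_deriveB (is_derive_cst (1 : R) Ws (1 : R)) dl)).
by field; rewrite gt_eqF.
Qed.

Lemma share_slope_ge0 i : 0 <= share_slope i.
Proof.
have [[_ f0 _] _ decr] := M_i; have := M_iv i; rewrite a_minusE /share_slope.
case: (a_plus M i) => [a| |]//; last first.
  by move=> _; rewrite subr0 !mulr_ge0// ltW// ?lower_edge_gt0.
rewrite lee_fin le_eqVlt => /predU1P[->|la]; first by rewrite subrr.
rewrite subr_ge0 ltW// decr ?ltr_pM2l//.
exact: ltW (threshold_lt i _ (lexx _)).
Qed.

Lemma share_slope_gt0 i : a_plus M i = +oo%E -> 0 < share_slope i.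
Proof.
have [[_ f0 _] _ decr] := M_i; rewrite /share_slope => ->; rewrite subr0.
have Wl0 : 0 < Ws * lower_edge M i by rewrite mulr_gt0 ?lower_edge_gt0.
(* Strict decrease from the edge to any later point, here one unit further, makes the nonnegative
   [x f(x)] positive at the edge. *)
apply: (@le_lt_trans _ _ ((Ws * lower_edge M i + 1) * f (Ws * lower_edge M i + 1))).
  by rewrite mulr_ge0// addr_ge0// ltW.
apply: decr; last by rewrite ltrDl.
exact: ltW (threshold_lt i _ (lexx _)).
Qed.

End SeveralClasses.

(** * The case of a single class *)

Section OneClass.
Context {R : realType} (M : model R 1).
Variable istar : R -> 'rV[R]_1 -> option 'I_1.
Hypothesis istarP : is_best_choice M istar.
Hypothesis M_iv : assumption_iv M.
Variable q : 'rV[R]_1.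
Hypothesis q_eq : is_unique_equilibrium M istar q.

(* With one class the service rate is constant, so the drift is a nonincreasing
   function of the queue length, and uniqueness makes [q] its only zero. *)
Lemma one_class_stable : exists eps : R, 0 < eps /\
  forall (Q0 : 'rV[R]_1) (Q : R -> 'rV[R]_1),
    in_orthant Q0 -> `|Q0 - q| < eps -> is_fluid_solution M istar Q0 Q ->
    Q t @[t --> +oo] --> q.
Proof.
have workload1 z : workload M z = beta M ord0 * z 0 ord0 by rewrite /workload big_ord1.
have beta0 : 0 < beta M ord0 := beta_gt0 M ord0.
pose g x := inflow M ord0 (beta M ord0 * x) - v M * mu M.
have driftE z : in_orthant z -> drift M ord0 z = g (z 0 ord0).
  move=> zo; rewrite /drift /service /g -workload1 mulfK//.
  by rewrite gt_eqF// workload_gt0.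
have q0 : 0 < q 0 ord0.
  by have := workload_gt0 M q (proj1 (proj1 q_eq)); rewrite workload1 pmulr_rgt0.
have drift_eq z : in_orthant z -> (is_equilibrium M istar z <-> drift M ord0 z = 0).
  move=> zo; rewrite /drift /inflow -(chiE M istar istarP)//; split; first by case=> _ /(_ ord0).
  by move=> d0; split=> // i; rewrite ord1.
have gq : g (q 0 ord0) = 0 by rewrite -driftE; [apply/drift_eq|]; have [] := proj1 q_eq.
have g_ninc x y : x <= y -> g y <= g x.
  move=> xy; rewrite lerD2r lerD2l ler_pM2l ?mulr_gt0 ?bo_gt0 ?Lambda_gt0// /share.
  (* The only class has the top rebate, so its market is unbounded above and just the lower edge
     moves with the workload. *)
  have -> : upper_cdf M ord0 = fun=> 1.
    have [i] := exists_top_rebate M isT; rewrite ord1 /upper_cdf => ->.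
    by [].
  rewrite lerD2l lerN2; apply: (law_cdf_ndecr (law M)).
  by rewrite ler_pM2r ?lower_edge_gt0// ler_pM2l.
have g_neq0 x : 0 < x -> x != q 0 ord0 -> g x != 0.
  move=> x0; apply: contra_neq => gx0; pose z : 'rV[R]_1 := const_mx x.
  have zx : z 0 ord0 = x by rewrite mxE.
  have zo : in_orthant z.
    split=> [i|]; first by rewrite mxE ltW.
    by apply: contraTneq x0 => z0; rewrite -zx z0 mxE ltxx.
  suff <- : z = q by rewrite zx.
  by apply: (proj2 q_eq); apply/(drift_eq _ zo); rewrite driftE// zx.
(* With this level, any [e] below it has square root [d < q 0 ord0], so [q 0 ord0 - d] is a positive
   queue length; for larger [e] no state qualifies. *)
apply: (lyapunov_criterion M istar istarP M_iv (fun=> 1) q _ (q 0 ord0 ^+ 2)) => //.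
  exact: exprn_gt0.
move=> e e0; have [Ue|eU] := leP (q 0 ord0 ^+ 2) e.
  by exists 1 => // z _ /(le_trans Ue); rewrite leNgt => /negbTE ->.
pose d := Num.sqrt e; have d0 : 0 < d by rewrite sqrtr_gt0.
have de : d ^+ 2 = e by rewrite sqr_sqrtr ?ltW.
have dq : d < q 0 ord0 by rewrite -ltr_sqr ?nnegrE ?ltW// de.
have gl : 0 < g (q 0 ord0 - d).
  rewrite lt_neqAle eq_sym g_neq0 ?subr_gt0 ?lt_eqF ?gtrBl//=.
  by rewrite -gq g_ninc// gerBl ltW.
have gr : g (q 0 ord0 + d) < 0.
  rewrite lt_neqAle g_neq0 ?addr_gt0 ?gt_eqF ?ltrDl//=.
  by rewrite -gq g_ninc// lerDl ltW.
(* At distance at least [d] from equilibrium, monotonicity bounds the drift by its value at the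
   nearer of the two points [q 0 ord0 - d] and [q 0 ord0 + d]. *)
exists (d * Num.min (g (q 0 ord0 - d)) (- g (q 0 ord0 + d))).
  by rewrite mulr_gt0// lt_min gl oppr_gt0.
move=> z zo; rewrite !big_ord1 !mul1r driftE// -de => dz _.
set x := z 0 ord0 in dz *; set y := q 0 ord0 in dz gl gr *.
have : d <= `|x - y|.
  by rewrite -ler_sqr ?nnegrE ?(ltW d0)// real_normK ?num_real.
rewrite ler_normr => /orP[xd|xd].
  apply: (@le_trans _ _ ((x - y) * g (y + d))).
    by rewrite ler_wpM2l ?(le_trans (ltW d0) xd)// g_ninc// addrC -lerBrDr.
  apply: (@le_trans _ _ (d * g (y + d))); first by rewrite ler_wnM2r// ltW.
  by rewrite -mulrN ler_pM2l// lerNr ge_min lexx orbT.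
rewrite opprB in xd; rewrite -opprB mulNr lerN2.
apply: (@le_trans _ _ (d * g (y - d))); first by rewrite ler_pM2l// ge_min lexx.
apply: (@le_trans _ _ ((y - x) * g (y - d))); first by rewrite ler_wpM2r// ltW.
by rewrite ler_wpM2l ?(le_trans (ltW d0) xd)// g_ninc// lerBrDr -lerBrDl.
Qed.

End OneClass.

(** * Local asymptotic stability *)

Theorem theorem3p10 (R : realType) (N : nat) (M : model R N)
    (istar : R -> 'rV[R]_N -> option 'I_N)
    (f : R -> R) (qhat qstar : 'rV[R]_N) :
  (1 <= N)%N ->
  is_best_choice M istar ->
  is_unique_equilibrium M istar qstar ->
  (forall i, 0 < qhat 0 i) ->
  assumption_i M f qhat qstar ->
  assumption_ii M ->
  assumption_iv M ->
  exists eps : R, 0 < eps /\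
    forall (Q0 : 'rV[R]_N) (Q : R -> 'rV[R]_N),
      in_orthant Q0 ->
      `|Q0 - qstar| < eps ->
      is_fluid_solution M istar Q0 Q ->
      Q t @[t --> +oo] --> qstar.
Proof.
move=> N0 istarP q_uniq qhat0 M_i _ M_iv.
case: N => [//|[|n]] in M istar qhat qstar N0 istarP q_uniq qhat0 M_i M_iv *.
  (* For one class [kappa] may equal the equilibrium workload; then (i) does not give [F' = f] at
     the lower edge itself, and monotonicity replaces linearisation. *)
  exact: one_class_stable istarP M_iv qstar q_uniq.
have Ws_gt0 := workload_gt0 M qstar q_uniq.1.1.
have What : 0 <= workload M qhat.
  by apply: sumr_ge0 => i _; rewrite mulr_ge0// ltW// beta_gt0.
have kappaP := kappa_bounds M M_iv qhat qstar isT What Ws_gt0.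
(* The class with the largest rebate has a strictly decreasing share and supplies the index with
   [phi > 0]. *)
have [i0 i0_top] := exists_top_rebate M N0.
apply: (equilibrium_stable M istar istarP M_iv qstar q_uniq.1
  (share_slope M f qstar) i0).
- exact: share_is_derive M_i Ws_gt0 kappaP.
- exact: share_slope_ge0 M_i Ws_gt0 kappaP.
- exact: share_slope_gt0 M_i Ws_gt0 kappaP i0 i0_top.
Qed.
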